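(* Let $K$ be an $NY$ compact space, and let $L$ be a compact space. If there exists a continuous linear map $T:C_p(K)\to C_p(L)$ such that $T(C_p(K))$ is dense in $C_p(L)$, then $L$ is $NY$ compact as well.
   Context: All topological spaces are Tychonoff (completely regular Hausdorff). $C_p(X)$ is the space of real-valued continuous functions on $X$ with the topology of pointwise convergence. For a family $\{X_\gamma:\gamma\in\Gamma\}$ of nonempty spaces and points $a_\gamma\in X_\gamma$, the $\sigma$-product is $\sigma(X_\gamma,a_\gamma,\Gamma)=\{(x_\gamma)\in\prod_{\gamma\in\Gamma}X_\gamma: |\{\gamma\in\Gamma:x_\gamma\neq a_\gamma\}|<\omega\}$, with the subspace topology from the product. A compact space is $NY$ compact if it is homeomorphic to a subspace of $\sigma(X_\gamma,a_\gamma,\Gamma)$ for some set $\Gamma$, some compact metrizable spaces $X_\gamma$ and some points $a_\gamma\in X_\gamma$. *)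

(* Defs.v *)
From HB Require Import structures.
From mathcomp Require Import all_boot all_order all_algebra.
From mathcomp Require Import all_classical all_reals all_analysis.
Import Order.TTheory GRing.Theory Num.Theory.
Import numFieldNormedType.Exports.

Set Implicit Arguments.
Unset Strict Implicit.
Unset Printing Implicit Defensive.

Local Open Scope classical_set_scope.
Local Open Scope ring_scope.

Definition tychonoff_space (T : topologicalType) : Prop :=
  completely_regular_space T /\ hausdorff_space T.

Definition homeomorphic (S T : topologicalType) : Prop :=
  exists (f : S -> T) (g : T -> S),
    [/\ continuous f, continuous g, cancel f g & cancel g f].

Definition metrizable (R : realType) (T : topologicalType) : Prop :=
  exists M : metricType R, homeomorphic T M.

Definition sigma_set (G : Type) (X : G -> topologicalType)
    (a : forall g, X g) : set (prod_topology X) :=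
  [set x | finite_set [set g | x g <> a g]].

(* A set used as a type is the library's [set_type], whose topology is the
   subspace topology. *)
Definition sigma_product (G : Type) (X : G -> topologicalType)
    (a : forall g, X g) : topologicalType :=
  set_type (sigma_set a).

Definition NY_compact (R : realType) (T : topologicalType) : Prop :=
  [/\ tychonoff_space T, compact [set: T] &
      exists (G : Type) (X : G -> topologicalType) (a : forall g, X g)
             (S : set (sigma_product a)),
        (forall g, compact [set: X g] /\ metrizable R (X g)) /\
        homeomorphic T (set_type S)].

(* The codomain is written [R^o] so that real-valued functions on [X] form an
   [lmodType R]. *)
Definition Cp (R : realType) (X : topologicalType) : Type :=
  continuousType X R^o.

Section Cp_structures.
Variables (R : realType) (X : topologicalType).

HB.instance Definition _ := Choice.on (Cp R X).

HB.instance Definition _ := Topological.copy (Cp R X)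
  (initial_topology (fun f : Cp R X => (f : {ptws X -> R^o}))).

Fact Cp_zero_continuous : continuous (0 : X -> R^o).
Proof. by move=> x; exact: cvg_cst. Qed.

Fact Cp_opp_continuous (f : Cp R X) : continuous (- (f : X -> R^o)).
Proof. by move=> x; apply: cvgN; exact: cts_fun. Qed.

Fact Cp_add_continuous (f g : Cp R X) :
  continuous ((f : X -> R^o) + (g : X -> R^o)).
Proof. by move=> x; apply: cvgD; exact: cts_fun. Qed.

Fact Cp_scale_continuous (c : R) (f : Cp R X) :
  continuous (c *: (f : X -> R^o)).
Proof. by move=> x; apply: cvgZr; exact: cts_fun. Qed.

Definition Cp_zero : Cp R X := mkcts Cp_zero_continuous.
Definition Cp_opp f : Cp R X := mkcts (@Cp_opp_continuous f).
Definition Cp_add f g : Cp R X := mkcts (@Cp_add_continuous f g).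
Definition Cp_scale c f : Cp R X := mkcts (@Cp_scale_continuous c f).

Fact Cp_addA : associative Cp_add.
Proof. by move=> f g h; apply/continuousEP => x; exact: addrA. Qed.
Fact Cp_addC : commutative Cp_add.
Proof. by move=> f g; apply/continuousEP => x; exact: addrC. Qed.
Fact Cp_add0 : left_id Cp_zero Cp_add.
Proof. by move=> f; apply/continuousEP => x; exact: add0r. Qed.
Fact Cp_addN : left_inverse Cp_zero Cp_opp Cp_add.
Proof. by move=> f; apply/continuousEP => x; exact: addNr. Qed.

HB.instance Definition _ :=
  GRing.isZmodule.Build (Cp R X) Cp_addA Cp_addC Cp_add0 Cp_addN.

Fact Cp_scaleA c d f : Cp_scale c (Cp_scale d f) = Cp_scale (c * d) f.
Proof. by apply/continuousEP => x; exact: mulrA. Qed.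
Fact Cp_scale1 : left_id 1 Cp_scale.
Proof. by move=> f; apply/continuousEP => x; exact: mul1r. Qed.
Fact Cp_scaleDr : right_distributive Cp_scale +%R.
Proof. by move=> c f g; apply/continuousEP => x; exact: mulrDr. Qed.
Fact Cp_scaleDl f : {morph Cp_scale^~ f : c d / c + d}.
Proof. by move=> c d; apply/continuousEP => x; exact: mulrDl. Qed.

HB.instance Definition _ := GRing.Zmodule_isLmodule.Build R (Cp R X)
  Cp_scaleA Cp_scale1 Cp_scaleDr Cp_scaleDl.

End Cp_structures.

(* Main.v *)
Require Import Defs.
From HB Require Import structures.
From mathcomp Require Import finmap all_boot all_order all_algebra.
From mathcomp Require Import all_classical all_reals all_analysis.
From mathcomp Require Import ring.
Import Order.TTheory GRing.Theory Num.Theory.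
Import numFieldNormedType.Exports.

Set Implicit Arguments.
Unset Strict Implicit.
Unset Printing Implicit Defensive.

Local Open Scope classical_set_scope.
Local Open Scope ring_scope.

(* NY compactness of X amounts to a point-separating family of continuous real
   functions split into countable blocks such that at every point only finitely
   many blocks contain a function that does not vanish there: sending a point
   to the sequence of values of each block embeds X into a sigma-product of
   compact metrizable spaces of sequences.

   Let f be such a family on K. For y in L the functional v |-> T v y on C_p(K)
   is continuous, so it only depends on the values of v on a finite subset A_y
   of K. The functions T m, where m runs over the monomials in the members of
   f, separate the points of L: on a finite set every function agrees with a
   polynomial in the members of f, so if y and z are not separated then
   T v y = T v z for all v, whence y = z by density of the range of T. Put m in
   the block indexed by the finite set F of blocks of f from which its factors
   are taken. If T m y <> 0 then m does not vanish at some x in A_y, so F is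
   contained in the finite set of blocks of f active at some point of A_y;
   hence only finitely many F are active at y. *)

(** * A metric for pointwise convergence of real sequences *)

Section sequence_metric.
Variable R : realType.
Implicit Types x y z : nat -> R.

(** Truncation at 1/(n+1) keeps the supremum finite for unbounded sequences and leaves only finitely
    many coordinates to control at each scale. *)
Definition seq_dist x y : R :=
  sup (range (fun n => Num.min `|x n - y n| n.+1%:R^-1)).

Let seq_dist_ubound x y :
  ubound (range (fun n => Num.min `|x n - y n| n.+1%:R^-1)) 1.
Proof.
move=> _ [n _ <-]; rewrite ge_min; apply/orP; right.
by rewrite invf_le1 ?ler1n.
Qed.

Lemma seq_dist_ge x y n : Num.min `|x n - y n| n.+1%:R^-1 <= seq_dist x y.
Proof. by apply: ub_le_sup; [exists 1; exact: seq_dist_ubound|exists n]. Qed.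

Lemma seq_dist_le x y (e : R) :
  (forall n, Num.min `|x n - y n| n.+1%:R^-1 <= e) -> seq_dist x y <= e.
Proof.
by move=> xye; apply: ge_sup; [exists (Num.min `|x 0%N - y 0%N| 1^-1), 0%N|
  move=> _ [n _ <-]].
Qed.

Lemma seq_distxx x : seq_dist x x = 0.
Proof.
apply/eqP; rewrite eq_le; apply/andP; split.
  by apply: seq_dist_le => n; rewrite subrr normr0 min_l.
by apply: le_trans (seq_dist_ge x x 0); rewrite subrr normr0 min_l.
Qed.

Lemma seq_dist0_eq x y : seq_dist x y = 0 -> x = y.
Proof.
move=> xy0; apply/funext => n; apply/eqP; rewrite -subr_eq0 -normr_le0.
have := seq_dist_ge x y n; rewrite xy0 ge_min => /orP[//|].
by rewrite leNgt invr_gt0 ltr0n.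
Qed.

Lemma seq_dist_sym x y : seq_dist x y = seq_dist y x.
Proof.
by rewrite /seq_dist; congr sup; congr image; apply/funext => n; rewrite distrC.
Qed.

Lemma seq_dist_triangle y x z : seq_dist x z <= seq_dist x y + seq_dist y z.
Proof.
apply: seq_dist_le => n.
apply: le_trans (lerD (seq_dist_ge x y n) (seq_dist_ge y z n)).
have e0 : 0 <= n.+1%:R^-1 :> R by rewrite invr_ge0.
have [_|_] := leP `|x n - y n|; have [_|_] := leP `|y n - z n|.
- by rewrite ge_min ler_distD.
- by rewrite ge_min lerDr normr_ge0 orbT.
- by rewrite ge_min lerDl normr_ge0 orbT.
- by rewrite ge_min lerDl e0 orbT.
Qed.

End sequence_metric.

(* An alias, because [set_type A] already stands for the subspace topology. *)
Definition seq_space (R : realType) (A : set (nat -> R)) : Type := set_type A.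

HB.instance Definition _ (R : realType) (A : set (nat -> R)) :=
  Choice.on (seq_space A).

HB.instance Definition _ (R : realType) (A : set (nat -> R)) :=
  @isMetric.Build R (seq_space A)
    (fun x y => seq_dist (set_val x) (set_val y))
    (fun x => seq_distxx (set_val x))
    (fun x y xy0 => val_inj (seq_dist0_eq xy0))
    (fun x y => seq_dist_sym (set_val x) (set_val y))
    (fun y x z => seq_dist_triangle (set_val y) (set_val x) (set_val z)).

Lemma continuous_seq_space (R : realType) (X : topologicalType)
    (A : set (nat -> R)) (h : nat -> Cp R X) (j : X -> seq_space A) :
  (forall x n, set_val (j x) n = h n x) -> continuous j.
Proof.
move=> jE x; apply/metricType_numDomainType.cvgrPdist_lt => e e0.
have e20 : 0 < e / 2 by rewrite divr_gt0.
(* From index [N] on, the truncation alone bounds the terms by e/2. Halving e makes up for the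
   supremum giving only a weak inequality. *)
pose N := Num.truncn (e / 2)^-1.
have : \forall y \near x, forall n : 'I_N, `|h n x - h n y| < e / 2.
  apply: filter_forall => n.
  by have /cvgrPdist_lt/(_ _ e20) := @cts_fun _ _ (h n) x.
apply: filterS => y xy; apply: (@le_lt_trans _ _ (e / 2)); last first.
  by rewrite ltr_pdivrMr// ltr_pMr// ltr1n.
apply: seq_dist_le => n; rewrite !jE ge_min.
have [nN|Nn] := ltnP n N; first by rewrite (ltW (xy (Ordinal nN))).
apply/orP; right; rewrite -[leRHS]invrK lef_pV2 ?posrE ?invr_gt0//.
rewrite (le_trans (ltW (truncnS_gt _)))//.
by rewrite ler_nat ltnS.
Qed.

(* [f g] is the block of index [g]. *)
Definition NY_family (R : realType) (X : topologicalType) (G : Type)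
    (f : G -> nat -> Cp R X) : Prop :=
  (forall x y, (forall g n, f g n x = f g n y) -> x = y) /\
  (forall x, finite_set [set g | exists n, f g n x <> 0]).

(** * From separating families to embeddings *)

Lemma continuous_prod_topology (X : topologicalType) (G : Type)
    (Y : G -> topologicalType) (j : X -> prod_topology Y) :
  (forall g, continuous (fun x => j x g)) -> continuous j.
Proof.
move=> cj x; apply/cvg_sup => g U [_ [[W oW <-] /= Wj WU]].
apply: filterS WU _; apply: (cj g x).
exact: open_nbhs_nbhs.
Qed.

Lemma continuous_set_type (X Y : topologicalType) (A : set Y)
    (j : X -> set_type A) :
  continuous (set_val \o j) -> continuous j.
Proof.
move=> cj; apply/continuousP => _ [W oW <-].
by move/continuousP : cj; apply.
Qed.

Lemma hausdorff_set_type (Y : topologicalType) (A : set Y) :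
  hausdorff_space Y -> hausdorff_space (set_type A).
Proof.
move=> hY x y xy; apply: val_inj; apply: hY => U V Ux Vy.
have cv := @initial_continuous _ _ (set_val : A -> Y).
by have [z [Uz Vz]] := xy _ _ (cv _ _ Ux) (cv _ _ Vy); exists (set_val z).
Qed.

Lemma compact_embedding (X Y : topologicalType) (j : X -> Y) :
  compact [set: X] -> hausdorff_space Y -> continuous j -> injective j ->
  homeomorphic X (set_type (range j)).
Proof.
move=> cX hY cj ij.
pose F x : range j := SigSub (mem_set (imageT j x)).
have gP (s : range j) : exists x, j x = set_val s.
  by have [x _ xs] := set_valP s; exists x.
have [g gE] := choice gP.
have cF : continuous F by apply: continuous_set_type; exact: cj.
have FK : cancel F g by move=> x; apply: ij; rewrite gE.
have gK : cancel g F by move=> s; apply: val_inj; rewrite /= gE.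
exists F, g; split=> //.
apply/continuous_closedP => C cC.
(* A closed subset of [X] is compact, so its image is compact and therefore closed in a Hausdorff
   space. *)
suff -> : g @^-1` C = F @` C.
  apply: compact_closed; first exact: hausdorff_set_type.
  apply: continuous_compact; first exact: continuous_subspaceT.
  exact: subclosed_compact cC cX _.
by apply/seteqP; split=> [s Cgs|_ [x Cx <-]]; [exists (g s)|rewrite /= FK].
Qed.

Lemma NY_family_compact (R : realType) (X : topologicalType) (G : Type)
    (f : G -> nat -> Cp R X) :
  tychonoff_space X -> compact [set: X] -> NY_family f -> NY_compact R X.
Proof.
move=> tX cX [fI ffin]; split=> //.
(* The zero sequence is adjoined to serve as base point; the factor stays compact, being a point
   together with a continuous image of [X]. *)
pose A g : set (nat -> R) := [set fun=> 0] `|` range (fun x n => f g n x).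
have A0 g : A g (fun=> 0) by left.
have Af g x : A g (fun n => f g n x) by right; exists x.
pose a g : seq_space (A g) := SigSub (mem_set (A0 g)).
pose j g x : seq_space (A g) := SigSub (mem_set (Af g x)).
have cj g : continuous (j g) by exact: (@continuous_seq_space _ _ _ (f g)).
pose Y g : topologicalType := seq_space (A g).
have jfin x : @sigma_set G Y a (j^~ x).
  apply: sub_finite_set (ffin x) => g /= jga; apply: contrapT => /forallNP fg0.
  by apply: jga; apply: val_inj; apply/funext => n; apply: contrapT => /fg0.
pose J x : @sigma_product G Y a := SigSub (mem_set (jfin x)).
exists G, Y, a, (range J); split.
  move=> g; split; last first.
    by exists (seq_space (A g)), id, id; split=> // s; exact: cvg_id.
  have -> : [set: Y g] = [set a g] `|` range (j g).
    apply/seteqP; split=> // s _.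
    have [s0|[x _ xs]] := set_valP s; first by left; exact: val_inj.
    by right; exists x => //; exact: val_inj.
  apply: compactU; first exact: compact_set1.
  by apply: continuous_compact => //; apply: continuous_subspaceT; exact: cj.
apply: compact_embedding => //.
- apply: hausdorff_set_type.
  apply: (@hausdorff_product {classic G} Y) => g.
  exact: (@metric_hausdorff R (seq_space (A g))).
- by apply: continuous_set_type; apply: continuous_prod_topology; exact: cj.
- move=> x y /(congr1 set_val) /= jxy; apply: fI => g n.
  by have := congr1 (fun z => set_val (z g) n) jxy.
Qed.

(** * From NY compact spaces to separating families *)

Lemma compact_metric_dense (R : realType) (M : metricType R) (a : M) :
  compact [set: M] ->
  exists q : nat -> M, forall x e, 0 < e -> exists n, mdist (q n) x < e.
Proof.
move=> cM.
pose P : ptopologicalType := HB.pack M (isPointed.Build M a).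
have {cM}: @cover_compact P [set: P] by rewrite -compact_cover.
move=> cM.
have net k : exists s : seq M, forall x, exists2 y, y \in s &
    mdist y x < k.+1%:R^-1.
  have k0 : 0 < k.+1%:R^-1 :> R by rewrite invr_gt0.
  have [||s _ sP] := cM M setT (fun y => (ball y k.+1%:R^-1)^°).
  - by move=> y _; exact: open_interior.
  - move=> x _; exists x => //; exact: nbhsx_ballx.
  exists (finmap.enum_fset s) => x; have [y ys xy] := sP x I.
  by exists y => //; have := interior_subset xy; rewrite ballEmdist.
have [s sP] := choice net.
(* The finite 1/(k+1)-nets are merged into one sequence through codes of pairs; [a] fills the
   numbers that name no net point. *)
exists (fun n => if unpickle n is Some (k, i) then nth a (s k) i else a).
move=> x e e0.
pose k := Num.truncn e^-1.
have [y ys xy] := sP k x.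
exists (pickle (k, index y (s k))); rewrite pickleK nth_index//.
apply: lt_trans xy _; rewrite -[ltRHS]invrK ltf_pV2 ?posrE ?invr_gt0//.
exact: truncnS_gt.
Qed.

Lemma compact_metrizable_separating (R : realType) (Y : topologicalType)
    (a : Y) :
  compact [set: Y] -> metrizable R Y ->
  exists h : nat -> Cp R Y, (forall n, h n a = 0) /\
    forall x y, (forall n, h n x = h n y) -> x = y.
Proof.
move=> cY [M [F [g [cF cg FK gK]]]].
have cM : compact [set: M].
  have -> : [set: M] = range F.
    by apply/seteqP; split=> // z _; exists (g z).
  by apply: continuous_compact => //; exact: continuous_subspaceT.
have [q qP] := compact_metric_dense (F a) cM.
(* Distances to a dense sequence determine a point; subtracting the value at [a] makes each function
   vanish there. *)
pose d n y : R^o := mdist (q n) (F y) - mdist (q n) (F a).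
have cd n : continuous (d n).
  move=> y; apply: cvgB; last exact: cvg_cst.
  apply/cvgrPdist_lt => e e0.
  have /metricType_numDomainType.cvgrPdist_lt/(_ _ e0) := cF y.
  apply: filterS => z; apply: le_lt_trans.
  rewrite ler_norml lerNl opprB !lerBlDl metric_triangle.
  by rewrite [X in _ + X]metric_sym metric_triangle.
exists (fun n => mkcts (@cd n)); split; first by move=> n; exact: subrr.
move=> x y dxy; apply: (can_inj FK); apply/eqP; rewrite -[_ == _]negbK.
rewrite -mdist_gt0; apply/negP => xy0.
(* A point of the sequence closer to [F x] than half the distance to [F y] cannot be equidistant
   from both. *)
have [n] := qP (F x) _ (divr_gt0 xy0 (ltr0n _ 2)).
have /= qxy : mdist (q n) (F x) = mdist (q n) (F y) by exact: addIr (dxy n).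
move=> qx; have := metric_triangle (F x) (q n) (F y).
by rewrite leNgt metric_sym -qxy [ltRHS]splitr ltrD.
Qed.

Lemma NY_compact_family (R : realType) (K : topologicalType) :
  NY_compact R K ->
  exists (G : Type) (f : G -> nat -> Cp R K), NY_family f.
Proof.
move=> [_ _ [G [Y [a [S [Yg [F [F' [cF _ FK _]]]]]]]]].
have hS g := cid (compact_metrizable_separating (a g) (Yg g).1 (Yg g).2).
pose h g := sval (hS g).
have hP g : (forall n, h g n (a g) = 0) /\
    forall x y, (forall n, h g n x = h g n y) -> x = y by exact: svalP (hS g).
pose p x : prod_topology Y := set_val (set_val (F x)).
have cp g : continuous (fun x => p x g).
  move=> x; apply: (@continuous_comp _ _ _ p (fun y => y g)); last first.
    exact: (@proj_continuous {classic G} Y g).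
  apply: (@continuous_comp _ _ _ (set_val \o F) set_val); last first.
    exact: initial_continuous.
  apply: continuous_comp; first exact: cF.
  exact: initial_continuous.
have cf g n : continuous (h g n \o p^~ g : K -> R^o).
  by move=> x; apply: continuous_comp; [exact: cp|exact: cts_fun].
exists G, (fun g n => mkcts (@cf g n)); split.
- move=> x y fxy; apply: (can_inj FK); do 2!apply: val_inj.
  apply: functional_extensionality_dep => g; apply: (hP g).2 => n.
  exact: fxy.
(* Since [h g n] vanishes at [a g], an active block is a coordinate off the base point. *)
- move=> x; apply: sub_finite_set (set_valP (set_val (F x))) => g /= [n].
  by apply: contra_not => pxa; have := (hP g).1 n; rewrite -pxa.
Qed.

(** * Monomials and finitely supported functionals *)

Section monomials.
Variables (R : realType) (X : topologicalType).

Lemma Cp_linE (c : R) (f g : Cp R X) x : (c *: f + g) x = c * f x + g x.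
Proof. by []. Qed.

Lemma continuous_Cp_mul (f g : Cp R X) : continuous (fun x => f x * g x : R^o).
Proof. by move=> x; apply: cvgM; exact: cts_fun. Qed.

Definition Cp_mul f g : Cp R X := mkcts (@continuous_Cp_mul f g).

Lemma Cp_mulE f g x : Cp_mul f g x = f x * g x.
Proof. by []. Qed.

Lemma continuous_Cp_one : continuous ((fun=> 1) : X -> R^o).
Proof. by move=> x; exact: cvg_cst. Qed.

Definition Cp_one : Cp R X := mkcts continuous_Cp_one.

Definition monomial (I : Type) (u : I -> Cp R X) (s : seq I) : Cp R X :=
  foldr (fun i m => Cp_mul (u i) m) Cp_one s.

Lemma monomialE (I : Type) (u : I -> Cp R X) s x :
  monomial u s x = \prod_(i <- s) u i x.
Proof.
elim: s => [|i s IHs]; first by rewrite big_nil.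
by rewrite big_cons -IHs.
Qed.

(* If [u i] takes distinct values at two points [x] and [y] of [A], then
   [h |-> psi ((u i - u i x) * h)] only depends on the values on [A \ {x}], so
   it is zero by induction. Hence [psi (u i * h)] equals both
   [u i x * psi h] and [u i y * psi h]. *)
Lemma finitely_supported_eq0 (I : Type) (u : I -> Cp R X)
    (psi : Cp R X -> R) (A : seq X) :
  (forall x y, (forall i, u i x = u i y) -> x = y) ->
  (forall c f g, psi (c *: f + g) = c * psi f + psi g) ->
  (forall f : Cp R X, (forall x, x \in A -> f x = 0) -> psi f = 0) ->
  (forall s, psi (monomial u s) = 0) ->
  forall f, psi f = 0.
Proof.
move=> uI; have [n] := ubnP (size A).
elim: n => // n IHn in psi A *; rewrite ltnS => An psiL psiA psi0 f.
have [[x [y [xA yA xy]]]|A1] :=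
    pselect (exists x y, [/\ x \in A, y \in A & x <> y]).
  have psiM z i : z \in A -> psi (Cp_mul (u i) f) = u i z * psi f.
    move=> zA; apply/eqP; rewrite -subr_eq0; apply/eqP.
    pose B := [seq a <- A | a != z].
    pose phi g := psi (Cp_mul (u i) g) - u i z * psi g.
    apply: (IHn phi B).
    - rewrite (leq_trans _ An)// size_filter -[ltnRHS](count_predC (pred1 z)).
      by rewrite -add1n leq_add2r -has_count has_pred1.
    - move=> c g h; rewrite /phi psiL.
      have -> : Cp_mul (u i) (c *: g + h) =
          c *: Cp_mul (u i) g + Cp_mul (u i) h.
        by apply/continuousEP => t; rewrite Cp_mulE !Cp_linE !Cp_mulE; ring.
      by rewrite psiL; ring.
    - move=> g gB; rewrite /phi addrC -mulNr -psiL; apply: psiA => t tA.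
      have [->|tz] := eqVneq t z.
        by rewrite Cp_linE Cp_mulE mulNr addNr.
      have gt0 : g t = 0 by apply: gB; rewrite mem_filter tz.
      by rewrite Cp_linE Cp_mulE gt0 !mulr0 addr0.
    - by move=> s; rewrite /phi psi0 (psi0 (i :: s)) mulr0 subrr.
  have [i uxy] : exists i, u i x <> u i y.
    by apply/existsNP => uxy; exact/xy/uI.
  apply/eqP; have /eqP : (u i x - u i y) * psi f = 0.
    by rewrite mulrBl -!psiM// subrr.
  by rewrite mulf_eq0 subr_eq0 => /orP[/eqP|].
(* With at most one distinct point in [A], [f] agrees on [A] with a multiple of the empty
   monomial. *)
have [x fA] : exists x, forall y, y \in A -> f y = x.
  case: A A1 {An psiA} => [|x A'] A1; first by exists 0.
  exists (f x) => y yA; congr (f _); apply: contrapT => yx.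
  by apply: A1; exists y, x; rewrite mem_head.
have : psi (- x *: monomial u [::] + f) = 0.
  apply: psiA => y yA; rewrite Cp_linE monomialE big_nil fA//.
  by rewrite mulr1 addNr.
by rewrite psiL psi0 mulr0 add0r.
Qed.

End monomials.

Lemma continuous_eval (R : realType) (X : topologicalType) (x : X) :
  continuous (fun f : Cp R X => f x : R^o).
Proof.
move=> f; apply: (@continuous_comp _ _ _ (fun f : Cp R X => f : {ptws X -> R^o})
  (fun g => g x)); first exact: initial_continuous.
exact: (@proj_continuous {classic X} (fun=> R^o) x).
Qed.

(* The subspaces of functions vanishing on a finite set form a filter base
   converging to 0. *)
Lemma continuous_finite_support (R : realType) (X : topologicalType)
    (phi : Cp R X -> R^o) :
  continuous phi -> (forall c f g, phi (c *: f + g) = c * phi f + phi g) ->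
  exists A : seq X,
    forall f : Cp R X, (forall x, x \in A -> f x = 0) -> phi f = 0.
Proof.
move=> cphi phiL.
pose Z (A : seq X) := [set f : Cp R X | forall x, x \in A -> f x = 0].
pose F := filter_from setT Z.
have FF : Filter F.
  apply: filter_from_filter; first by exists [::].
  move=> A B _ _; exists (A ++ B) => // f fAB.
  by split=> x xA; apply: fAB; rewrite mem_cat xA ?orbT.
have phi0 : phi 0 = 0.
  by have := phiL (-1) 0 0; rewrite scaler0 addr0 mulN1r addNr.
have F0 : F --> (0 : Cp R X).
  move=> U [_ [[W oW <-] /= W0 WU]]; apply: (filterS WU).
  have : (fun f : Cp R X => f : {ptws X -> R^o}) @ F --> (0 : {ptws X -> R^o}).
    apply/cvg_sup => x V [_ [[V' oV' <-] /= V'0 V'V]].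
    exists [:: x] => // f fx; apply: V'V => /=.
    by rewrite fx ?mem_head.
  by apply; exact: open_nbhs_nbhs.
have := cvg_trans (cvg_app phi F0) (cphi 0); rewrite phi0.
move=> /cvgr0Pnorm_lt/(_ 1 ltr01)[A _ AP].
(* Rescaling [f] so that [phi] takes the value 1 keeps it zero on [A], against the bound [AP]. *)
exists A => f fA; apply: contrapT => /eqP phif.
have := AP ((phi f)^-1 *: f).
have -> : phi ((phi f)^-1 *: f) = 1.
  by rewrite -[_ *: f]addr0 phiL phi0 addr0 mulVf.
rewrite normr1 ltxx => /(_ _)/negP; apply=> // x xA.
by rewrite -[_ *: f]addr0 Cp_linE fA// mulr0 addr0.
Qed.

(** * Countable blocks of monomials *)

Section blocks.
Variables (R : realType) (K : topologicalType) (G : choiceType).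
Variable f : G -> nat -> Cp R K.

Let u (p : G * nat) := f p.1 p.2.

(* The monomials whose set of block indices is exactly [F] are enumerated by
   [pickle] of words over the countable type [F * nat]. *)
Definition block_monomial (F : {fset G}) (n : nat) : Cp R K :=
  if unpickle n is Some c then
    let s := [seq (val p.1, p.2) | p : F * nat <- c] in
    if (F `<=` [fset p.1 | p in s])%fset then monomial u s else 0
  else 0.

Lemma monomial_block s : exists F n, block_monomial F n = monomial u s.
Proof.
pose F := [fset p.1 | p in s]%fset.
have [c cs] : exists c : seq (F * nat), [seq (val p.1, p.2) | p <- c] = s.
  have : {in s, forall p, p.1 \in F} by move=> p ps; apply/imfsetP; exists p.
  (* Forgetting how [F] arose from [s] lets the induction lift every tail over the same [F]. *)
  move: F => F; elim: s => [|p s IHs] sF; first by exists [::].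
  have [c cs] := IHs (sub_in1 (@mem_behead _ (p :: s)) sF).
  exists (([` sF p (mem_head p s)]%fset, p.2) :: c).
  by rewrite /= cs -surjective_pairing.
by exists F, (pickle c); rewrite /block_monomial pickleK/= cs fsubset_refl.
Qed.

Lemma block_monomial_neq0 F n x :
  block_monomial F n x <> 0 -> forall g, g \in F -> exists m, f g m x <> 0.
Proof.
rewrite /block_monomial; case: unpickle => [c|//]; case: ifP => [Fc|//].
rewrite monomialE => /eqP; rewrite prodf_seq_neq0 => /allP cx g gF.
have /imfsetP[p /= pc gp] := fsubsetP Fc g gF.
by exists p.2; apply/eqP; rewrite gp; exact: cx.
Qed.

End blocks.

(** * Density and the transfer from [K] to [L] *)

Lemma continuous_evalB (R : realType) (X : topologicalType) (x y : X) :
  continuous (fun f : Cp R X => f x - f y : R^o).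
Proof.
move=> f.
exact: (cvgB (@continuous_eval R X x f) (@continuous_eval R X y f)).
Qed.

(** The functions that distinguish [x] from [y] form an open set, nonempty by complete regularity,
    so [D] meets it. *)
Lemma dense_separating (R : realType) (X : topologicalType) (D : set (Cp R X)) :
  tychonoff_space X -> dense D ->
  forall x y, (forall f, D f -> f x = f y) -> x = y.
Proof.
move=> [crX hX] dD x y Dxy; apply: contrapT => xy.
have cl1 : closed [set y] by exact/accessible_closed_set1/hausdorff_accessible.
have sep := crX x _ cl1 xy.
pose v : Cp R X := mkcts (@Urysohn_continuous X R [set x] [set y]).
have vx : v x = 0 by apply: (Urysohn_sub0 sep); exists x.
have vy : v y = 1 by apply: (Urysohn_sub1 sep); exists y.
have [||f []] := dD ((fun f : Cp R X => f x - f y : R^o) @^-1` ~` [set 0]).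
- by exists v => /=; rewrite vx vy sub0r => /eqP; rewrite oppr_eq0 oner_eq0.
- apply: open_comp; first by move=> ? _; exact: continuous_evalB.
  exact/closed_openC/accessible_closed_set1/hausdorff_accessible/Rhausdorff.
- by move=> + Df; rewrite /= (Dxy f Df) subrr; exact.
Qed.

Theorem theorem4p11 (R : realType) (K L : topologicalType)
    (NYK : NY_compact R K)
    (tychL : tychonoff_space L) (compL : compact [set: L])
    (T : {linear Cp R K -> Cp R L}) (ctsT : continuous T)
    (denseT : dense (range T)) :
  NY_compact R L.
Proof.
have [G [f [fI ffin]]] := NY_compact_family NYK.
(* [{classic G}] equips the bare type [G] with the choice structure that finite subsets require. *)
pose h (F : {fset {classic G}}) n := T (@block_monomial R K {classic G} f F n).
have supp y : exists A : seq K,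
    forall v : Cp R K, (forall x, x \in A -> v x = 0) -> T v y = 0.
  apply: (@continuous_finite_support _ _ (fun v => T v y)).
    move=> v; apply: (@continuous_comp _ _ _ T (fun w => w y : R^o)).
      exact: ctsT.
    exact: continuous_eval.
  by move=> c v w; rewrite linearP.
apply: (@NY_family_compact _ _ _ h) => //; split.
- move=> y z hyz; apply: (dense_separating tychL denseT) => _ [v _ <-].
  have [A Ay] := supp y; have [B Bz] := supp z.
  apply/eqP; rewrite -subr_eq0; apply/eqP.
  apply: (@finitely_supported_eq0 _ _ (G * nat)%type (fun p => f p.1 p.2)
    (fun v => T v y - T v z) (A ++ B)).
  + by move=> a b fab; apply: fI => g n; exact: (fab (g, n)).
  + by move=> c v1 v2; rewrite linearP !Cp_linE; ring.
  + move=> w w0; rewrite Ay ?Bz ?subrr// => x xAB; apply: w0.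
      by rewrite mem_cat xAB orbT.
    by rewrite mem_cat xAB.
  + move=> s; have [F [n <-]] := @monomial_block R K {classic G} f s.
    by rewrite [X in X - _](hyz F n) subrr.
- move=> y; have [A Ay] := supp y.
  have : finite_set (\bigcup_(x in [set` A]) [set g | exists n, f g n x <> 0]).
    by apply: bigcup_finite => // x _; exact: ffin.
  move=> /(@finite_fsetP {classic G})[B BE].
  (* [B] collects the blocks of [f] active somewhere on [A]; the active [F] all lie in its finite
     power set. *)
  apply: sub_finite_set (finite_fset (fpowerset B)) => F [n hFn] /=.
  rewrite fpowersetE; apply/fsubsetP => g gF.
  have [x xA bx] : exists2 x, x \in A &
      @block_monomial R K {classic G} f F n x <> 0.
    apply: contrapT => nA; apply: hFn; apply: Ay => x xA.
    by apply: contrapT => bx; apply: nA; exists x.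
  suff : [set` B] g by [].
  by rewrite -BE; exists x => //; exact: (block_monomial_neq0 bx).
Qed.
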